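(* For all integers $n\ge 0$ and all integers $k\ge j\ge 0$, \[ a_{3(k-j)+3,\;3k+6}(3n+1)\equiv a_{3(k-j)+3,\;3k+6}(3n+2)\equiv 0 \pmod 3. \]
   Context: For positive integers $r,s$, $a_{r,s}(n)$ denotes the number of multicolored partitions of $n$ in which each even part may appear in one of $r$ colors and each odd part may appear in one of $s$ colors (copies of the same part size in different colors are distinct), with $a_{r,s}(0)=1$. Equivalently, for $|q|<1$, $\sum_{n\ge0}a_{r,s}(n)q^n = f_2^{s-r}/f_1^{s}$, where $f_m=\prod_{i\ge1}(1-q^{mi})$. *)

(* Defs.v *)
From mathcomp Require Import all_boot.

Set Implicit Arguments.
Unset Strict Implicit.
Unset Printing Implicit Defensive.

Definition num_colors (r s i : nat) : nat := if odd i then s else r.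

(* The parts that can occur in a partition of n: the index i : 'I_n stands for
   the part size i.+1, so that sizes range over 1, ..., n. *)
Definition colored_part (r s n : nat) : finType :=
  {i : 'I_n & 'I_(num_colors r s i.+1)}.

Definition part_size (r s n : nat) (p : colored_part r s n) : nat :=
  (tag p).+1.

(* A multicolored partition of n is a multiset of colored parts, given by its
   multiplicities; no multiplicity can exceed n. *)
Definition colored_partitions (r s n : nat) :
    {set {ffun colored_part r s n -> 'I_n.+1}} :=
  [set m : {ffun colored_part r s n -> 'I_n.+1} |
    \sum_p m p * part_size p == n].

Definition a (r s n : nat) : nat := #|colored_partitions r s n|.

(* Main.v *)
Require Import Defs.
From mathcomp Require Import all_boot.
From mathcomp Require Import all_fingroup all_solvable.
From mathcomp Require Import zify.

(** Both numbers of colors are multiples of 3, so the colors of every part size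
    can be split into blocks of three. Rotating the colors within the blocks is
    a size-preserving permutation of order 3 of the colored parts, and it acts
    on the multicolored partitions of [N]. The multiplicities of a fixed
    partition are constant on the blocks, so 3 divides its total [N]. If 3 does
    not divide [N], there is thus no fixed partition, and 3 divides the number
    of partitions. *)

(** The cyclic group generated by [f] is a [p]-group acting on [S], so [#|S|] is congruent modulo
    [p] to the number of fixed points in [S], here zero. *)
Lemma prime_dvd_card_no_fixpoint (T : finType) (S : {set T}) (p : nat)
    (f : T -> T) :
  prime p -> iter p f =1 id -> {in S, forall x, f x \in S} ->
  {in S, forall x, f x != x} -> p %| #|S|.
Proof.
move=> p_pr fp fS f_neq.
have f_inj : injective f.
  apply: (can_inj (g := iter p.-1 f)) => x.
  by rewrite -iterSr (prednK (prime_gt0 p_pr)) fp.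
pose t := perm f_inj.
have tp : (t ^+ p = 1)%g.
  by apply/permP => x; rewrite permX perm1 -[RHS]fp; apply: eq_iter => y; rewrite permE.
have pG : (p.-group <[t]>)%g.
  by apply: (pnat_dvd (n := p)); rewrite ?pnat_id // order_dvdn tp.
have actS : ([acts <[t]>, on S | 'P])%g.
  rewrite cycle_subG !inE; apply/subsetP => x xS.
  by rewrite inE /= /aperm permE fS.
have := pgroup_fix_mod pG actS.
suff -> : ('Fix_(S | 'P)(<[t]>) = set0)%g by rewrite cards0 /dvdn mod0n => ->.
apply/setP => x; rewrite in_setI in_set0; apply/negP => /andP[xS /afixP/(_ t (cycle_id t))].
by rewrite /= /aperm permE => /eqP; apply/negP/f_neq.
Qed.

(** A 3-cycle on each block 3m, 3m+1, 3m+2 of color indices. *)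
Definition rot3 (i : nat) : nat := if i %% 3 == 2 then i - 2 else i.+1.

Lemma rot3K i : rot3 (rot3 (rot3 i)) = i.
Proof. rewrite /rot3; do ![case: eqP]; lia. Qed.

Lemma rot3_mod i : rot3 i %% 3 = i.+1 %% 3.
Proof. rewrite /rot3; case: eqP; lia. Qed.

Lemma ltn_rot3 c i : 3 %| c -> i < c -> rot3 i < c.
Proof. rewrite /rot3; case: eqP; lia. Qed.

Section ColorRotation.

Variables (r s N : nat).
Hypotheses (r3 : 3 %| r) (s3 : 3 %| s).

Local Notation part := (colored_part r s N).

Lemma num_colors_dvd3 i : 3 %| num_colors r s i.
Proof. by rewrite /num_colors; case: ifP. Qed.

Definition rotate_color (p : part) : part :=
  Tagged (fun i : 'I_N => 'I_(num_colors r s i.+1))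
    (Ordinal (ltn_rot3 _ _ (num_colors_dvd3 _) (ltn_ord (tagged p)))).

Definition color_class (p : part) : nat := tagged p %% 3.

Lemma rotate_colorK p : rotate_color (rotate_color (rotate_color p)) = p.
Proof.
case: p => i c; rewrite /rotate_color /=; congr (existT _ _ _).
by apply: val_inj; rewrite /= rot3K.
Qed.

Lemma rotate_color_bij : bijective rotate_color.
Proof.
by exists (fun p => rotate_color (rotate_color p)) => p; rewrite rotate_colorK.
Qed.

Lemma color_class_rotate p : color_class (rotate_color p) = (color_class p).+1 %% 3.
Proof. by rewrite /color_class /= rot3_mod -addn1 -modnDml addn1. Qed.

(** Rotation carries each color class bijectively onto the next and preserves [F], so the three
    classes contribute equal sums. *)
Lemma dvd3_sum_rotate_invariant (F : part -> nat) :
  (forall p, F (rotate_color p) = F p) -> 3 %| \sum_p F p.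
Proof.
move=> Frot.
have shift (k : 'I_3) : \sum_(p | color_class p == k) F p =
    \sum_(p | color_class p == 0) F p.
  have step l : l < 2 -> \sum_(p | color_class p == l.+1) F p =
      \sum_(p | color_class p == l) F p.
    move=> l2; rewrite (reindex rotate_color) /=; last exact/onW_bij/rotate_color_bij.
    apply: eq_big => [p|p _]; last exact: Frot.
    (* Since [l < 2], the successor modulo 3 takes the value [l.+1] only at class [l]. *)
    rewrite color_class_rotate /color_class; lia.
  by case: k => [[|[|[|//]]] ?] /=; rewrite ?step.
(* [color_class] with values in the finite type ['I_3], as [partition_big] requires. *)
pose cls (p : part) : 'I_3 := Ordinal (ltn_pmod (tagged p) (isT : 0 < 3)).
rewrite (partition_big cls predT) //=.
rewrite (eq_bigr (fun=> \sum_(p | color_class p == 0) F p)); last first.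
  by move=> k _; rewrite -(shift k); apply: eq_bigl.
by rewrite sum_nat_const card_ord dvdn_mulr.
Qed.

Lemma dvd3_colored_partitions : ~~ (3 %| N) -> 3 %| a r s N.
Proof.
move=> N3.
pose f (m : {ffun part -> 'I_N.+1}) := [ffun p => m (rotate_color p)].
apply: (@prime_dvd_card_no_fixpoint _ _ 3 f) => // m.
- by apply/ffunP => p; rewrite !ffunE rotate_colorK.
- rewrite !inE => /eqP sum_m; apply/eqP; apply: etrans sum_m.
  (* Rotation changes only the color of a part, so [part_size] is unaffected by the reindexing. *)
  rewrite [RHS](reindex rotate_color) /=; last exact/onW_bij/rotate_color_bij.
  by apply: eq_bigr => p _; rewrite ffunE.
- rewrite inE => /eqP sum_m; apply: contraNneq N3 => fm.
  suff: 3 %| \sum_p m p * part_size p by rewrite sum_m.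
  apply: dvd3_sum_rotate_invariant => p.
  by rewrite -[in RHS]fm ffunE.
Qed.

End ColorRotation.

Theorem theorem1p6 (n k j : nat) (hjk : j <= k) :
  a (3 * (k - j) + 3) (3 * k + 6) (3 * n + 1) = 0 %[mod 3] /\
  a (3 * (k - j) + 3) (3 * k + 6) (3 * n + 2) = 0 %[mod 3].
Proof.
by split; apply/eqP; rewrite mod0n; apply: dvd3_colored_partitions; lia.
Qed.
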